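(* Let $\mathcal H$ be a complex Hilbert space and $d\in\mathbb N$. The formula $$D^\rho(\mathsf S,\mathsf T)=\tfrac12\bigl(\rho(\mathsf S-\mathsf T)+\rho(\mathsf T-\mathsf S)\bigr),\qquad \mathsf S,\mathsf T\in\mathcal B(\mathcal H)^d,$$ defines a metric on $\mathcal B(\mathcal H)^d$, where $\rho$ denotes the Toeplitz modulus.
   Context: $\mathcal B(\mathcal H)$ is the algebra of bounded operators on the Hilbert space $\mathcal H$; operations on $d$-tuples are entrywise. For $\mathsf T=(T_1,\dots,T_d)\in\mathcal B(\mathcal H)^d$ and $\alpha\in\mathbb R_+=[0,\infty)$, let $\mathcal T_\alpha$ be the $(d+1)\times(d+1)$ Toeplitz operator matrix on $\bigoplus_1^{d+1}\mathcal H$ whose $(i,j)$ entry is $\alpha 1_{\mathcal H}$ if $i=j$, $T_{i-j}$ if $i>j$, and $T_{j-i}^*$ if $i<j$. The Toeplitz modulus is $\rho(\mathsf T)=\inf\{\alpha\in\mathbb R_+ : \mathcal T_\alpha\text{ is positive (semidefinite)}\}$. *)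

(* Defs.v *)
From HB Require Import structures.
From mathcomp Require Import all_boot all_order all_algebra sesquilinear complex.
From mathcomp Require Import boolp classical_sets functions reals topology.
From mathcomp Require Import normedtype.

Set Implicit Arguments.
Unset Strict Implicit.
Unset Printing Implicit Defensive.

Import Order.TTheory GRing.Theory Num.Theory.
Import numFieldNormedType.Exports.

Local Open Scope ring_scope.
Local Open Scope classical_set_scope.
Local Open Scope complex_scope.

(* [inner] is linear in its first argument and conjugate-linear in the second;
   completeness is that of the norm it induces. *)
HB.mixin Record CompleteNormedModule_isHilbert (R : realType) H
    of CompleteNormedModule R[i] H := {
  inner : {dot H for @Num.conj R[i]} ;
  sqr_norm_inner : forall x : H, `|x| ^+ 2 = inner x x }.

#[short(type="hilbertType")]
HB.structure Definition Hilbert (R : realType) :=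
  {H of CompleteNormedModule R[i] H & CompleteNormedModule_isHilbert R H}.

Notation "''[' x , y ]" := (inner x y) : ring_scope.

Section BoundedOperators.
Context {R : realType} (H : hilbertType R).

Definition is_bounded_operator : {pred H -> H} := fun f =>
  `[< linear f /\ exists M : R, forall x, `|f x| <= M%:C * `|x| >].

Lemma is_bounded_operator_submod : submod_closed is_bounded_operator.
Proof.
split.
  apply/asboolP; split; first by move=> a x y; rewrite /= addr0 scaler0.
  by exists 0 => x; rewrite normr0 mul0r.
move=> a f g /asboolP[lf [M fM]] /asboolP[lg [N gN]]; apply/asboolP; split.
  move=> b x y; rewrite !fctE lf lg !scalerDr !scalerA mulrC.
  by rewrite -!addrA; congr (_ + _); rewrite addrCA.
exists (complex.Re `|a| * M + N) => x.
have -> : (complex.Re `|a| * M + N)%:C = `|a| * M%:C + N%:C.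
  by rewrite rmorphD rmorphM.
rewrite fctE mulrDl; apply: (le_trans (ler_normD _ _)); apply: lerD => //.
by rewrite normrZ -mulrA ler_wpM2l.
Qed.

HB.instance Definition _ := GRing.isSubmodClosed.Build R[i] (H -> H)
  is_bounded_operator is_bounded_operator_submod.

Record bounded_operator := BoundedOperator {
  bounded_operator_fun :> H -> H ;
  bounded_operatorP : bounded_operator_fun \in is_bounded_operator }.

HB.instance Definition _ := [isSub for bounded_operator_fun].
HB.instance Definition _ := gen_eqMixin bounded_operator.
HB.instance Definition _ := gen_choiceMixin bounded_operator.
HB.instance Definition _ :=
  [SubChoice_isSubLmodule of bounded_operator by <:].

Fact idop_subproof : (id : H -> H) \in is_bounded_operator.
Proof. by apply/asboolP; split=> //; exists 1 => x; rewrite mul1r. Qed.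

Definition idop : bounded_operator := BoundedOperator idop_subproof.

End BoundedOperators.

Notation "''B' ( H )" := (bounded_operator H)
  (at level 8, format "''B' ( H )") : type_scope.

Section ToeplitzModulus.
Context {R : realType} {H : hilbertType R}.

(* The operator S with <T x, y> = <x, S y> for all x and y: it is unique, and it
   exists by the Riesz representation theorem, so that the default value 0 of
   [xget] is never used. *)
Definition adjoint (T : 'B(H)) : 'B(H) :=
  xget 0 [set S : 'B(H) | forall x y, '[T x, y] = '[x, S y]].

(* A matrix of operators acts on the Hilbert direct sum of n copies of H, whose
   elements are the families 'I_n -> H and whose inner product is
   (x, y) |-> \sum_i '[x i, y i]. *)
Definition opmx_apply n (A : 'M['B(H)]_n) (x : 'I_n -> H) : 'I_n -> H :=
  fun i => \sum_(j < n) A i j (x j).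

Definition dsum_inner n (x y : 'I_n -> H) : R[i] := \sum_(i < n) '[x i, y i].

(* [0 <= z] in R[i] says that z is real and nonnegative. *)
Definition opmx_positive n (A : 'M['B(H)]_n) : Prop :=
  forall x : 'I_n -> H, 0 <= dsum_inner (opmx_apply A x) x.

(* T_k, with the indexing 1 <= k <= d of the tuple (T_1, ..., T_d); in
   [toeplitz] it is only used for such k. *)
Definition tuple_coord d (T : {ffun 'I_d -> 'B(H)}) (k : nat) : 'B(H) :=
  oapp T 0 (insub k.-1).

Definition toeplitz d (T : {ffun 'I_d -> 'B(H)}) (a : R) : 'M['B(H)]_d.+1 :=
  \matrix_(i, j)
    if i == j then a%:C *: idop H
    else if (j < i)%N then tuple_coord T (i - j)%N
    else adjoint (tuple_coord T (j - i)%N).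

Definition toeplitz_modulus d (T : {ffun 'I_d -> 'B(H)}) : R :=
  inf [set a : R | 0 <= a /\ opmx_positive (toeplitz T a)].

Definition Drho d (S T : {ffun 'I_d -> 'B(H)}) : R :=
  2^-1 * (toeplitz_modulus (S - T) + toeplitz_modulus (T - S)).

End ToeplitzModulus.

Definition is_metric (R : realType) (M : Type) (dist : M -> M -> R) : Prop :=
  [/\ forall x y, 0 <= dist x y,
      forall x y, dist x y = 0 <-> x = y,
      forall x y, dist x y = dist y x &
      forall x y z, dist x z <= dist x y + dist y z].

(* Main.v *)
(* The quadratic form of the Toeplitz matrix of T and a at the family x equals
     a * sum_i |x_i|^2 + 2 Re sum_(j < i) <T_(i-j) x_j, x_i>,
   where the adjoints above the diagonal account for the factor 2 Re; they exist
   by Riesz representation.  The second term is additive in T and bounded by a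
   multiple of sum_i |x_i|^2, so rho(T) is the least a >= 0 making the form
   nonnegative, and rho is subadditive.  If rho(T) = 0, the family with x_0 = h,
   x_k = - T_k h and zeros elsewhere gives - |T_k h|^2 >= 0, hence T = 0. *)
Require Import Defs.
From mathcomp Require Import all_boot all_order all_algebra sesquilinear complex.
From mathcomp Require Import boolp classical_sets functions reals topology.
From mathcomp Require Import normedtype ring lra.

Set Implicit Arguments.
Unset Strict Implicit.
Unset Printing Implicit Defensive.

Import Order.TTheory GRing.Theory Num.Theory.
Import numFieldNormedType.Exports.

Local Open Scope ring_scope.
Local Open Scope classical_set_scope.
Local Open Scope complex_scope.

(** * Real parts of complex numbers *)

Section RealPart.
Context {R : rcfType}.
Implicit Types z w : R[i].

Lemma ReD z w : complex.Re (z + w) = complex.Re z + complex.Re w.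
Proof. by case: z w => [? ?] [? ?]. Qed.

Lemma ReM_real (a : R) z : complex.Re (a%:C * z) = a * complex.Re z.
Proof. by case: z => [? ?] /=; rewrite mul0r subr0. Qed.

Lemma Re_conj z : complex.Re z^* = complex.Re z.
Proof. by case: z. Qed.

End RealPart.

(** * The real inner product space underlying [H] *)

Section RealInner.
Context {R : realType} {H : hilbertType R}.
Implicit Types x y z : H.

(** Real parts move order arguments from [R[i]] to [R]; the norm loses nothing, being already
    real. *)
Definition rinner x y : R := complex.Re '[x, y].
Definition rnorm x : R := complex.Re `|x|.

Lemma rnormE x : `|x| = (rnorm x)%:C.
Proof. by rewrite RRe_real// normr_real. Qed.

Lemma rnorm_ge0 x : 0 <= rnorm x.
Proof. by rewrite -ler0c -rnormE. Qed.

Lemma rnorm_eq0 x : rnorm x = 0 -> x = 0.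
Proof. by move=> x0; apply: normr0_eq0; rewrite rnormE x0. Qed.

Lemma ler_rnormD x y : rnorm (x + y) <= rnorm x + rnorm y.
Proof. by rewrite -lecR rmorphD /= -!rnormE; exact: ler_normD. Qed.

Lemma inner_conj x y : '[y, x] = ('[x, y])^*.
Proof. by rewrite hermC expr0 mul1r. Qed.

Lemma inner_self x : '[x, x] = (rnorm x ^+ 2)%:C.
Proof. by rewrite -sqr_norm_inner rnormE rmorphXn. Qed.

Lemma rinnerC x y : rinner x y = rinner y x.
Proof. by rewrite /rinner inner_conj Re_conj. Qed.

Lemma rinnerDl x y z : rinner (x + y) z = rinner x z + rinner y z.
Proof. by rewrite /rinner linearDl ReD. Qed.

Lemma rinnerDr x y z : rinner z (x + y) = rinner z x + rinner z y.
Proof. by rewrite rinnerC rinnerDl !(rinnerC z). Qed.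

Lemma rinnerZl (a : R) x y : rinner (a%:C *: x) y = a * rinner x y.
Proof. by rewrite /rinner linearZl ReM_real. Qed.

Lemma rinnerZr (a : R) x y : rinner x (a%:C *: y) = a * rinner x y.
Proof. by rewrite rinnerC rinnerZl rinnerC. Qed.

Lemma rinner0l x : rinner 0 x = 0.
Proof. by have := rinnerDl 0 0 x; rewrite addr0; lra. Qed.

Lemma rinner0r x : rinner x 0 = 0.
Proof. by rewrite rinnerC rinner0l. Qed.

Lemma rinnerNl x y : rinner (- x) y = - rinner x y.
Proof. by apply/eqP; rewrite -addr_eq0 -rinnerDl addNr rinner0l. Qed.

Lemma rinnerNr x y : rinner x (- y) = - rinner x y.
Proof. by rewrite rinnerC rinnerNl rinnerC. Qed.

Lemma rinner_self x : rinner x x = rnorm x ^+ 2.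
Proof. by rewrite /rinner inner_self. Qed.

Lemma rnormD_sqr x y :
  rnorm (x + y) ^+ 2 = rnorm x ^+ 2 + 2 * rinner x y + rnorm y ^+ 2.
Proof.
rewrite -!rinner_self rinnerDl !rinnerDr (rinnerC y x).
by rewrite mulr2n mulrDl mul1r !addrA.
Qed.

(** Squaring the triangle inequality |x + y| <= |x| + |y| and expanding leaves exactly this
    bound. *)
Lemma rinner_CS x y : rinner x y <= rnorm x * rnorm y.
Proof.
have : rnorm (x + y) ^+ 2 <= (rnorm x + rnorm y) ^+ 2.
  by rewrite lerXn2r ?nnegrE ?addr_ge0 ?rnorm_ge0// ler_rnormD.
by rewrite rnormD_sqr; lra.
Qed.

Lemma rnormN x : rnorm (- x) = rnorm x.
Proof. by rewrite /rnorm normrN. Qed.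

Lemma rinner_CS_opp x y : - (rnorm x * rnorm y) <= rinner x y.
Proof. by rewrite lerNl -rinnerNl -(rnormN x) rinner_CS. Qed.

Lemma inner_ext x y : (forall z, '[z, x] = '[z, y]) -> x = y.
Proof.
move=> xy; apply/eqP; rewrite -subr_eq0; apply/eqP/rnorm_eq0/eqP.
rewrite -sqrf_eq0 -rinner_self rinnerDr rinnerNr.
by rewrite /rinner xy subrr.
Qed.

End RealInner.

(** * Riesz representation by minimization *)

Section Riesz.
Context {R : realType} {H : hilbertType R}.
Variables (f : H -> R[i]) (M : R).
Hypothesis f_linear : forall (a : R[i]) x y, f (a *: x + y) = a * f x + f y.
Hypothesis f_bounded : forall x, complex.Re (f x) <= M * rnorm x.

Let g x := complex.Re (f x).

Let gD x y : g (x + y) = g x + g y.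
Proof. by rewrite /g -{1}(scale1r x) f_linear mul1r ReD. Qed.

Let fZ a x : f (a *: x) = a * f x.
Proof.
have f0 : f 0 = 0.
  apply: (addIr (f 0)).
  by rewrite -{1}(mul1r (f 0)) -f_linear scaler0 !add0r.
by rewrite -[a *: x]addr0 f_linear f0 addr0.
Qed.

Let gZ (a : R) x : g (a%:C *: x) = a * g x.
Proof. by rewrite /g fZ ReM_real. Qed.

(* A minimizer of this functional represents [f]; by [J_close] its sublevel sets
   form a Cauchy filter, so that completeness provides one. *)
Let J x := rnorm x ^+ 2 - 2 * g x.

Let m := inf (range J).

(** Completing the square: J x >= (|x| - M)^2 - M^2. *)
Let J_lb x : - M ^+ 2 <= J x.
Proof. rewrite /J; have := f_bounded x; have := sqr_ge0 (rnorm x - M); nra. Qed.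

Let J_has_inf : has_inf (range J).
Proof.
split; first by exists (J 0), 0.
by exists (- M ^+ 2) => _ [x _ <-]; exact: J_lb.
Qed.

Let m_le x : m <= J x.
Proof. by apply: ge_inf; [exact: J_has_inf.2 | exists x]. Qed.

Let J_add x y : J (x + y) = J x + (rnorm y ^+ 2 + 2 * (rinner x y - g y)).
Proof. by rewrite /J rnormD_sqr gD; ring. Qed.

(** Parallelogram law: |x - y|^2 = 2 J x + 2 J y - 4 J((x + y) / 2), and the midpoint value is at
    least [m]. *)
Let J_close x y : rnorm (x - y) ^+ 2 <= 2 * (J x - m) + 2 * (J y - m).
Proof.
have := m_le (2^-1%:C *: (x + y)).
rewrite /J gZ gD -!rinner_self rinnerZl rinnerZr.
rewrite !rinnerDl !rinnerDr !rinnerNl !rinnerNr (rinnerC y x) !rinner_self.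
lra.
Qed.

Let F : set_system H :=
  [set A | exists2 e : R, 0 < e & [set x | J x < m + e] `<=` A].

Let F_filter : ProperFilter F.
Proof.
apply: Build_ProperFilter_ex => [A [e e0 eA]|].
  have [_ [x _ <-] xe] := inf_adherent e0 J_has_inf.
  by exists x; exact: eA.
split; first by exists 1.
  move=> A B [e e0 eA] [e' e'0 eB]; exists (Num.min e e').
    by rewrite lt_min e0 e'0.
  by move=> x /= xe; split; [apply: eA | apply: eB] => /=;
    rewrite (lt_le_trans xe)// lerD2l ge_min lexx ?orbT.
by move=> A B AB [e e0 eA]; exists e => // x /eA/AB.
Qed.

Let F_cvg : cvg F.
Proof.
have F_Filter : Filter F by case: F_filter.
apply: (@cauchy_cvg H F F_filter).
apply: (@cauchy_exP _ H F) => eps eps0.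
have [e e0 ->] : exists2 e : R, 0 < e & eps = e%:C.
  by exists (complex.Re eps); rewrite -?ltcR RRe_real// gtr0_real.
(* By [J_close], two points with J below m + e^2 / 4 are at distance less than e. *)
have e24 : 0 < e ^+ 2 / 4 by rewrite divr_gt0// exprn_gt0.
have [_ [x _ <-] xe] := inf_adherent e24 J_has_inf.
exists x, (e ^+ 2 / 4) => // y /= ye.
rewrite -ball_normE /= rnormE ltcR -(@ltr_pXn2r _ 2)// ?nnegrE ?rnorm_ge0 ?ltW//.
by apply: le_lt_trans (J_close x y) _; rewrite -/m in xe; lra.
Qed.

Let J_min : exists l, forall x, J l <= J x.
Proof.
have [l Fl] : exists l : H, F --> l by exists (lim F); exact: F_cvg.
exists l.
suff Jm : J l <= m by move=> x; exact: le_trans Jm (m_le x).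
apply/ler_addgt0Pr => e e0.
(* Since J l - J y <= 2 (|l| + |M|) |l - y|, the bounds |l - y| < e / c and J y < m + e / c give J l
   <= m + e. *)
pose c := 1 + 2 * (rnorm l + `|M|).
have c0 : 0 < c by rewrite ltr_wpDr// mulr_ge0// addr_ge0// rnorm_ge0.
have e'0 : 0 < e / c by rewrite divr_gt0.
have [d d0 dl] : F (ball l (e / c)%:C).
  by apply: Fl; apply: nbhsx_ballx; rewrite ltcR.
have de0 : 0 < Num.min d (e / c) by rewrite lt_min d0 e'0.
have [_ [y _ <-]] := inf_adherent de0 J_has_inf; rewrite -/m => ye.
have {}dl : rnorm (l - y) < e / c.
  rewrite -ltcR -rnormE.
  suff : ball l (e / c)%:C y by rewrite -ball_normE.
  by apply: dl; rewrite /= (lt_le_trans ye)// lerD2l ge_min lexx.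
have {}ye : J y < m + e / c.
  by rewrite (lt_le_trans ye)// lerD2l ge_min lexx orbT.
(* The inner product is taken with the fixed [l] instead of [y], so that the estimate is uniform in
   [y]. *)
have -> : J l = J y + (2 * rinner l (l - y) - 2 * g (l - y)
                       - rnorm (l - y) ^+ 2).
  have lE : l = y + (l - y) by rewrite subrKC.
  by rewrite {1 2}lE J_add rinnerDl rinner_self; ring.
(* [f_bounded] is one-sided, so it is applied to the opposite vector. *)
have gN : - g (l - y) <= `|M| * rnorm (l - y).
  have -> : - g (l - y) = g ((-1)%:C *: (l - y)) by rewrite gZ mulN1r.
  apply: le_trans (f_bounded _) _; rewrite rmorphN1 scaleN1r.
  by rewrite rnormN ler_wpM2r ?rnorm_ge0// ler_norm.
have rl := rinner_CS l (l - y).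
have -> : e = e / c + 2 * (rnorm l + `|M|) * (e / c).
  by rewrite -{1}[e / c]mul1r -mulrDl mulrC divfK ?gt_eqF.
have : (rnorm l + `|M|) * rnorm (l - y) <= (rnorm l + `|M|) * (e / c).
  by rewrite ler_wpM2l ?(ltW dl)// addr_ge0// rnorm_ge0.
have := sqr_ge0 (rnorm (l - y)).
lra.
Qed.

Let riesz_re : exists l, forall x, g x = rinner x l.
Proof.
have [l lJ] := J_min; exists l => x; rewrite rinnerC.
apply/eqP; rewrite eq_sym -subr_eq0; set p := _ - _.
(* Moving from [l] by -p s x changes J by p^2 s (s |x|^2 - 2) = - p^2 s (1 + s), so minimality
   forces p = 0. The added 1 keeps [s] defined at x = 0. *)
pose s := (rnorm x ^+ 2 + 1)^-1.
have s0 : 0 < s by rewrite invr_gt0 ltr_wpDl// sqr_ge0.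
have := lJ (l + (- p * s)%:C *: x).
rewrite J_add gZ rinnerZr -mulrBr -/p -(rinner_self (_ *: _)).
rewrite rinnerZl rinnerZr rinner_self lerDl => h.
have sE : s * rnorm x ^+ 2 = 1 - s.
  rewrite -[1](mulVf (_ : rnorm x ^+ 2 + 1 != 0)) ?gt_eqF ?ltr_wpDl ?sqr_ge0//.
  by rewrite -/s; ring.
have {}h : 0 <= p ^+ 2 * s * (s * rnorm x ^+ 2 - 2) by apply: le_trans h _; lra.
rewrite -sqrf_eq0 eq_le sqr_ge0 andbT; move: h; rewrite sE.
have := mulr_ge0 (sqr_ge0 p) (ltW s0).
nra.
Qed.

Lemma riesz_representation : exists l, forall x, f x = '[x, l].
Proof.
have [l lP] := riesz_re; exists l => x.
(* The real identity at i x yields the imaginary parts. *)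
have lx := lP x; have := lP ('i *: x).
rewrite /g /rinner fZ linearZl /= in lx *.
move: (f x) '[x, l] lx => [a b] [a' b'] /= <-; rewrite !mul0r !mul1r !sub0r.
by move/oppr_inj => <-.
Qed.

End Riesz.

(** * Adjoints of bounded operators *)

Section Adjoint.
Context {R : realType} {H : hilbertType R}.
Implicit Types (S T : 'B(H)) (x y : H).

Lemma bounded_operator_linear T : linear T.
Proof. by have /asboolP[] := bounded_operatorP T. Qed.

Lemma bounded_operator_bound T :
  exists2 M : R, 0 <= M & forall x, rnorm (T x) <= M * rnorm x.
Proof.
have /asboolP[_ [M TM]] := bounded_operatorP T.
exists `|M| => // x; apply: le_trans (_ : M * rnorm x <= _).
  by rewrite -lecR rmorphM /= -!rnormE; exact: TM.
by rewrite ler_wpM2r ?rnorm_ge0// ler_norm.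
Qed.

Lemma bounded_operator0 T : T 0 = 0.
Proof.
apply: (addIr (T 0)).
by rewrite -{1}(scale1r (T 0)) -bounded_operator_linear scaler0 !add0r.
Qed.

(** Riesz represents x |-> <T x, y> for each y. The resulting map S is linear by [inner_ext], and
    bounded because |S y|^2 = Re <T (S y), y> <= M |y| |S y|. *)
Lemma adjoint_exists T :
  exists S, forall x y, '[T x, y] = '[x, S y].
Proof.
have [M M0 TM] := bounded_operator_bound T.
have Tle x y : rinner (T x) y <= M * rnorm y * rnorm x.
  apply: le_trans (rinner_CS _ _) _.
  by rewrite mulrAC ler_wpM2r ?rnorm_ge0.
have /choice[S TS] : forall y, exists z, forall x, '[T x, y] = '[x, z].
  move=> y; apply: (@riesz_representation _ _ _ (M * rnorm y)).
    by move=> a x x'; rewrite bounded_operator_linear linearDl linearZl.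
  by move=> x; exact: Tle.
have SB : S \in @is_bounded_operator R H.
  apply/asboolP; split.
    move=> a x y; apply: inner_ext => z.
    by rewrite -TS !linearDr !linearZr /= !TS.
  exists M => x; rewrite !rnormE -rmorphM lecR.
  have [->|Sx0] := eqVneq (rnorm (S x)) 0; first by rewrite mulr_ge0 ?rnorm_ge0.
  rewrite -(@ler_pM2r _ (rnorm (S x))) ?lt_def ?Sx0 ?rnorm_ge0//.
  by rewrite -expr2 -rinner_self /rinner -TS; exact: Tle.
by exists (BoundedOperator SB) => x y; exact: TS.
Qed.

Lemma adjointP T x y : '[T x, y] = '[x, adjoint T y].
Proof.
have [S TS] := adjoint_exists T.
by apply: (@xgetPex _ 0 [set S : 'B(H) | forall x y, '[T x, y] = '[x, S y]]);
  exists S.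
Qed.

Lemma inner_adjoint T x y : '[adjoint T y, x] = ('[T x, y])^*.
Proof. by rewrite inner_conj -adjointP. Qed.

End Adjoint.

(** * The quadratic form of the Toeplitz matrix *)

Section ToeplitzForm.
Context {R : realType} {H : hilbertType R} {d : nat}.
Implicit Types (S T : {ffun 'I_d -> 'B(H)}) (x : 'I_d.+1 -> H).

Definition dsum_sqnorm x : R := \sum_i rnorm (x i) ^+ 2.

Definition toeplitz_form T x : R :=
  \sum_(i < d.+1) \sum_(j < d.+1 | (j < i)%N)
    rinner (tuple_coord T (i - j) (x j)) (x i).

Lemma dsum_inner_toeplitz T (a : R) x :
  dsum_inner (opmx_apply (toeplitz T a) x) x =
  (a * dsum_sqnorm x + 2 * toeplitz_form T x)%:C.
Proof.
pose c (i j : 'I_d.+1) := '[tuple_coord T (i - j) (x j), x i].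
(* Each row is split into its diagonal, lower and upper entries. *)
transitivity (\sum_i (a * rnorm (x i) ^+ 2)%:C
    + \sum_(i < d.+1) \sum_(j < d.+1 | (j < i)%N) c i j
    + \sum_(i < d.+1) \sum_(j < d.+1 | (i < j)%N) (c j i)^*).
  rewrite -!big_split; apply: eq_bigr => i _ /=.
  rewrite linear_sumlz /=.
  rewrite (bigD1 i)//= (bigID (fun j : 'I_d.+1 => (j < i)%N))/= addrA.
  congr (_ + _ + _).
  - by rewrite mxE eqxx linearZl /= inner_self -rmorphM.
  - apply: eq_big => [j|j /andP[ij ji]].
      by case: ltngtP => //; rewrite ?andbF ?andbT// -val_eqE /=; case: ltngtP.
    by rewrite mxE eq_sym (negbTE ij) ji.
  - apply: eq_big => [j|j /andP[ij ji]].
      by rewrite -val_eqE /=; case: ltngtP.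
    by rewrite mxE eq_sym (negbTE ij) (negbTE ji) inner_adjoint.
(* Transposing the upper sum pairs each lower term with its conjugate. *)
rewrite [X in _ + X](exchange_big_dep xpredT)//= -addrA -big_split /=.
rewrite rmorphD /dsum_sqnorm /toeplitz_form !mulr_sumr !rmorph_sum.
congr (_ + _); apply: eq_bigr => i _.
rewrite mulr_sumr rmorph_sum -big_split; apply: eq_bigr => j _ /=.
by rewrite addcJ -/(c i j) rmorphM /= rmorph_nat.
Qed.


Lemma tuple_coordD S T k :
  tuple_coord (S + T) k = tuple_coord S k + tuple_coord T k.
Proof.
by rewrite /tuple_coord; case: insubP => [i _ _|_] /=; rewrite ?ffunE ?addr0.
Qed.

Lemma toeplitz_formD S T x :
  toeplitz_form (S + T) x = toeplitz_form S x + toeplitz_form T x.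
Proof.
rewrite /toeplitz_form -big_split; apply: eq_bigr => i _.
rewrite -big_split; apply: eq_bigr => j _ /=.
by rewrite tuple_coordD -rinnerDl.
Qed.

Lemma toeplitz_form0 x : toeplitz_form 0 x = 0.
Proof. by have := toeplitz_formD 0 0 x; rewrite addr0; lra. Qed.

Lemma dsum_sqnorm_ge0 x : 0 <= dsum_sqnorm x.
Proof. by apply: sumr_ge0 => i _; exact: sqr_ge0. Qed.

Lemma toeplitz_positiveP T (a : R) :
  opmx_positive (toeplitz T a) <->
  forall x, 0 <= a * dsum_sqnorm x + 2 * toeplitz_form T x.
Proof.
by split=> aT x; have := aT x; rewrite dsum_inner_toeplitz ler0c.
Qed.

End ToeplitzForm.

(** * Positivity, subadditivity and definiteness of the modulus *)

Section ToeplitzModulusTheory.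
Context {R : realType} {H : hilbertType R} {d : nat}.
Implicit Types (S T : {ffun 'I_d -> 'B(H)}) (x : 'I_d.+1 -> H).

(** Provides an admissible [a], so that the infimum is over a nonempty set. The entries are bounded
    one by one and their constants added. *)
Lemma toeplitz_form_bound T :
  exists2 K : R, 0 <= K &
    forall x, 0 <= K * dsum_sqnorm x + 2 * toeplitz_form T x.
Proof.
have /choice[c cP] : forall p : 'I_d.+1 * 'I_d.+1, exists c, 0 <= c /\
    forall x, 0 <= c * dsum_sqnorm x +
      2 * rinner (tuple_coord T (p.1 - p.2) (x p.2)) (x p.1).
  move=> [i j] /=.
  have [M M0 TM] := bounded_operator_bound (tuple_coord T (i - j)).
  (* 2 M |x_i| |x_j| <= M (|x_i|^2 + |x_j|^2), and each square is at most [dsum_sqnorm x]. *)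
  exists (2 * M); split=> [|x]; first by rewrite mulr_ge0.
  have xN k : rnorm (x k) ^+ 2 <= dsum_sqnorm x.
    rewrite /dsum_sqnorm (bigD1 k)//= lerDl.
    by apply: sumr_ge0 => l _; exact: sqr_ge0.
  have := rinner_CS_opp (tuple_coord T (i - j) (x j)) (x i).
  have := ler_wpM2r (rnorm_ge0 (x i)) (TM (x j)).
  have := ler_wpM2l M0 (xN i); have := ler_wpM2l M0 (xN j).
  have := mulr_ge0 M0 (sqr_ge0 (rnorm (x i) - rnorm (x j))).
  by rewrite sqrrB; lra.
exists (\sum_(i < d.+1) \sum_(j < d.+1 | (j < i)%N) c (i, j)).
  by apply: sumr_ge0 => i _; apply: sumr_ge0 => j _; exact: (cP _).1.
move=> x; rewrite mulr_suml mulr_sumr -big_split; apply: sumr_ge0 => i _ /=.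
rewrite mulr_suml mulr_sumr -big_split; apply: sumr_ge0 => j _ /=.
exact: (cP (i, j)).2.
Qed.

Lemma toeplitz_modulus_has_inf T :
  has_inf [set a : R | 0 <= a /\ opmx_positive (toeplitz T a)].
Proof.
split; last by exists 0 => a [].
by have [K K0 TK] := toeplitz_form_bound T; exists K; split=> //;
  apply/toeplitz_positiveP.
Qed.

Lemma toeplitz_modulus_ge0 T : 0 <= toeplitz_modulus T.
Proof.
by apply: lb_le_inf => [|a []//]; exact: (toeplitz_modulus_has_inf T).1.
Qed.

Lemma toeplitz_modulus_le T (a : R) : 0 <= a ->
  (forall x, 0 <= a * dsum_sqnorm x + 2 * toeplitz_form T x) ->
  toeplitz_modulus T <= a.
Proof.
move=> a0 aT; apply: ge_inf; first exact: (toeplitz_modulus_has_inf T).2.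
by split=> //; apply/toeplitz_positiveP.
Qed.

(** The infimum is attained: for fixed [x] the condition is affine in [a], hence closed. *)
Lemma toeplitz_modulus_form_ge0 T x :
  0 <= toeplitz_modulus T * dsum_sqnorm x + 2 * toeplitz_form T x.
Proof.
apply/ler_addgt0Pr => e e0.
have N0 := dsum_sqnorm_ge0 x.
have N1 : 0 < dsum_sqnorm x + 1 by rewrite ltr_wpDl.
(* Multiplied by [dsum_sqnorm x], this error stays below [e]; the added 1 covers x = 0. *)
have e'0 : 0 < e / (dsum_sqnorm x + 1) by rewrite divr_gt0.
have [a [a0 /toeplitz_positiveP/(_ x) aT]] :=
  inf_adherent e'0 (toeplitz_modulus_has_inf T).
rewrite -/(toeplitz_modulus T) => ae.
have := ler_wpM2r N0 (ltW ae).
have : e = e / (dsum_sqnorm x + 1) * (dsum_sqnorm x + 1).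
  by rewrite divfK ?gt_eqF.
lra.
Qed.

(** Adding the inequalities for S and T at their moduli shows that the sum of the moduli is
    admissible for S + T. *)
Lemma toeplitz_modulusD S T :
  toeplitz_modulus (S + T) <= toeplitz_modulus S + toeplitz_modulus T.
Proof.
apply: toeplitz_modulus_le => [|x].
  by rewrite addr_ge0 ?toeplitz_modulus_ge0.
rewrite toeplitz_formD; have := toeplitz_modulus_form_ge0 S x.
by have := toeplitz_modulus_form_ge0 T x; lra.
Qed.

Lemma toeplitz_modulus0 : toeplitz_modulus (0 : {ffun 'I_d -> 'B(H)}) = 0.
Proof.
apply/eqP; rewrite eq_le toeplitz_modulus_ge0 andbT.
by apply: toeplitz_modulus_le => // x; rewrite mul0r toeplitz_form0 mulr0 addr0.
Qed.

(** Only the entry in row k + 1 and column 0 survives; its operator has index k + 1 counted from 1,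
    which is [T k] counted from 0. *)
Lemma toeplitz_form_two_coords T (k : 'I_d) (h g : H) :
  toeplitz_form T
    (fun i => if i == ord0 then h else if i == lift ord0 k then g else 0) =
  rinner (T k h) g.
Proof.
rewrite /toeplitz_form (bigD1 (lift ord0 k))//= [X in _ + X]big1 ?addr0.
  rewrite (bigD1 ord0)//= [X in _ + X]big1 ?addr0.
    by rewrite /tuple_coord eqxx /= valK.
  move=> j /andP[jk j0]; rewrite (negbTE j0) -val_eqE /= ltn_eqF//.
  by rewrite bounded_operator0 rinner0l.
move=> i ik; have [->|i0] := eqVneq i ord0; first by rewrite big_pred0_eq.
by rewrite (negbTE ik) big1// => j _; rewrite rinner0r.
Qed.

Lemma toeplitz_modulus_eq0 T : toeplitz_modulus T = 0 -> T = 0.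
Proof.
move=> T0; apply/ffunP => k; rewrite ffunE; apply/val_inj/funext => h.
apply/rnorm_eq0/eqP; rewrite -sqrf_eq0 eq_le sqr_ge0 andbT.
have := toeplitz_modulus_form_ge0 T
  (fun i => if i == ord0 then h else if i == lift ord0 k then - T k h else 0).
rewrite T0 mul0r add0r toeplitz_form_two_coords rinnerNr rinner_self.
lra.
Qed.

End ToeplitzModulusTheory.

(** No relation between rho (- x) and rho x is assumed: averaging both orders gives symmetry, and
    the triangle inequality is subadditivity used once in each direction. *)
Lemma symmetrized_modulus_metric (R : realType) (V : zmodType) (rho : V -> R) :
  (forall x, 0 <= rho x) -> rho 0 = 0 -> (forall x, rho x = 0 -> x = 0) ->
  (forall x y, rho (x + y) <= rho x + rho y) ->
  is_metric (fun x y => 2^-1 * (rho (x - y) + rho (y - x))).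
Proof.
move=> rho_ge0 rho0 rho_eq0 rhoD; split=> [x y|x y|x y|x y z].
- by rewrite mulr_ge0 ?invr_ge0 ?addr_ge0.
- split=> [xy|->]; last by rewrite subrr rho0 addr0 mulr0.
  apply/eqP; rewrite -subr_eq0; apply/eqP/rho_eq0.
  by have := rho_ge0 (x - y); have := rho_ge0 (y - x); lra.
- by rewrite addrC.
- have := rhoD (x - y) (y - z); have := rhoD (z - y) (y - x).
  by rewrite !subrKA; lra.
Qed.

Theorem proposition4p5 (R : realType) (H : hilbertType R) (d : nat) :
  is_metric (fun S T : {ffun 'I_d -> 'B(H)} => Drho S T).
Proof.
apply: (@symmetrized_modulus_metric _ _ (@toeplitz_modulus R H d)).
- exact: toeplitz_modulus_ge0.
- exact: toeplitz_modulus0.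
- exact: toeplitz_modulus_eq0.
- exact: toeplitz_modulusD.
Qed.
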